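(* For every positive integer $n$, $$a_n=\sum_{i=1}^{n}\ \prod_{j=1}^{n-1} 2^{\,d_{i,j}+d_{n+1-i,j}}\cdot\bigl(b_{i,j}+b_{n+1-i,j}\bigr)!,$$ where in this formula the convention $d_{p,1}=0$ for all $p$ is used.
   Context: Places $1,\dots,n$ stand in a row; neighbouring places have distance $1$. At any time at which at least one place is occupied, the distance of an empty place $x$ is $\min|x-y|$ over all occupied places $y$. Persons arrive one after another and each occupies one empty place. Politeness rule: every person except the first (who chooses freely unless stated otherwise) occupies one of the empty places whose distance is maximal among all empty places at that time. $a_n$ is the number of sequences $(x_1,\dots,x_n)$ (permutations of $\{1,\dots,n\}$, $x_t$ being the place taken by the $t$-th person) in which $n$ persons fill all $n$ places obeying the politeness rule. For positive integers $p,k$, consider $p$ places filled by $p$ persons according to the politeness rule with the first person taking the leftmost place. $b_{p,k}$ is the number of persons (the first person is not counted) who, at the moment of choosing, occupy a place of distance exactly $k$. For $k\ge 2$, $d_{p,k}$ is the number of different sets of two neighbouring places for which, at some time during the filling, both places are empty and both have distance exactly $k$; moreover, in this statement $d_{p,1}:=0$ for all $p$. These numbers do not depend on the choices made during the filling. Empty products equal $1$. *)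

(* Defs.v *)
(* Mathematical Components *)
From mathcomp Require Import all_boot all_order all_algebra.

Set Implicit Arguments.
Unset Strict Implicit.
Unset Printing Implicit Defensive.

Import IntDist.

(* The places 1, ..., p are represented by 0, ..., p - 1 in 'I_p, and the
   persons are likewise numbered from 0.  Distances are not affected. *)

(* Two places are always at distance less than p, so for nonempty O the
   default value p does not affect the minimum. *)
Definition place_dist (p : nat) (O : {set 'I_p}) (x : 'I_p) : nat :=
  \big[minn/p]_(y in O) `|x - y|%N.

(* The places occupied once the first t persons have chosen. *)
Definition occupied (p : nat) (x : p.-tuple 'I_p) (t : nat) : {set 'I_p} :=
  [set tnth x u | u : 'I_p & u < t].

Definition polite_choice (p : nat) (O : {set 'I_p}) (x : 'I_p) : bool :=
  (x \notin O) &&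
  [forall y : 'I_p, (y \notin O) ==> (place_dist O y <= place_dist O x)].

Definition polite_filling (p : nat) (x : p.-tuple 'I_p) : bool :=
  uniq x &&
  [forall t : 'I_p, (0 < t) ==> polite_choice (occupied x t) (tnth x t)].

Definition starts_leftmost (p : nat) (x : p.-tuple 'I_p) : bool :=
  [forall t : 'I_p, (t == 0 :> nat) ==> (tnth x t == 0 :> nat)].

Definition a_num (n : nat) : nat :=
  #|[set x : n.-tuple 'I_n | polite_filling x]|.

(* b_{p,k} and d_{p,k} are the values of b_num x k and d_num x k at any polite
   filling x of p places that starts with the leftmost place. *)
Definition b_num (p : nat) (x : p.-tuple 'I_p) (k : nat) : nat :=
  #|[set t : 'I_p | (0 < t) && (place_dist (occupied x t) (tnth x t) == k)]|.

Definition neighbours (p : nat) (P : {set 'I_p}) : bool :=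
  [exists y : 'I_p, exists z : 'I_p, (z == y.+1 :> nat) && (P == [set y; z])].

(* The times considered are those after t choices with 0 < t < p: no distance
   is defined for t = 0, and no place is empty for t = p. *)
Definition d_num (p : nat) (x : p.-tuple 'I_p) (k : nat) : nat :=
  if k == 1 then 0 else
  #|[set P : {set 'I_p} | neighbours P &&
      [exists t : 'I_p,
        [&& 0 < t, [disjoint P & occupied x t] &
            [forall z in P, place_dist (occupied x t) z == k]]]]|.

Lemma polite_choice_exists (p : nat) (O : {set 'I_p}) :
  #|O| < p -> exists x, polite_choice O x.
Proof.
move=> ltOp; have : 0 < #|~: O| by rewrite cardsCs setCK card_ord subn_gt0.
case/card_gt0P=> x0; rewrite inE => x0O.
case: (@arg_maxnP _ x0 (fun y => y \notin O) (place_dist O) x0O) => x xO xmax.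
exists x; rewrite /polite_choice xO; apply/forallP => y.
by apply/implyP; apply: xmax.
Qed.

Lemma occupiedE (p : nat) (x : p.-tuple 'I_p) (t : nat) :
  occupied x t = [set y in take t x].
Proof.
apply/setP=> y; rewrite inE; apply/imsetP/idP => [[u ut ->]|yt].
  rewrite inE in ut.
  have -> : tnth x u = nth y (take t x) u by rewrite nth_take // (tnth_nth y).
  by apply: mem_nth; rewrite size_take size_tuple; case: ifP.
have := yt; rewrite -index_mem size_take_min size_tuple leq_min => /andP[it ip].
exists (Ordinal ip); first by rewrite inE.
by rewrite (tnth_nth y) /= -[RHS](nth_take y it) nth_index.
Qed.

Lemma leftmost_polite_filling_exists (p : nat) :
  exists x : p.-tuple 'I_p, polite_filling x && starts_leftmost x.
Proof.
case: p => [|q].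
  by exists [tuple]; rewrite /polite_filling; apply/andP; split;
    [apply/andP; split => //|]; apply/forallP; case.
have H m : m <= q -> exists s : seq 'I_q.+1, [/\ size s = m.+1, uniq s,
    nth ord0 s 0 = ord0 & forall t, 0 < t < m.+1 ->
      polite_choice [set y in take t s] (nth ord0 s t)].
  elim: m => [_|m IHm ltm].
    by exists [:: ord0]; split=> // t; case: t => [|[]].
  have [s [ss us hs ps]] := IHm (ltnW ltm).
  have [|x Px] := @polite_choice_exists q.+1 [set y in s].
    by rewrite cardsE (card_uniqP us) ss.
  exists (rcons s x); split.
  - by rewrite size_rcons ss.
  - by rewrite rcons_uniq us andbT; case/andP: Px; rewrite inE.
  - by rewrite nth_rcons ss.
  move=> t /andP[t0]; rewrite ltnS leq_eqVlt => /orP[/eqP->|tm].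
    by rewrite -cats1 -ss take_size_cat // nth_cat ltnn subnn.
  rewrite nth_rcons ss tm -cats1 takel_cat ?ss 1?ltnW //.
  by apply: ps; rewrite t0.
have [s [ss us hs ps]] := H q (leqnn q).
have ss' : size s == q.+1 by apply/eqP.
exists (Tuple ss'); apply/andP; split.
  apply/andP; split=> //; apply/forallP => t; apply/implyP => t0.
  by rewrite occupiedE (tnth_nth ord0) /=; apply: ps; rewrite t0 ltn_ord.
apply/forallP => t; apply/implyP => /eqP t0.
by rewrite (tnth_nth ord0) t0 /= hs.
Qed.

(* Main.v *)
Require Import Defs.
From mathcomp Require Import all_boot all_order all_algebra.
From mathcomp Require Import zify.

Set Implicit Arguments.
Unset Strict Implicit.
Unset Printing Implicit Defensive.

Import IntDist.

(* Let B_j(O) and D_j(O) be the numbers of persons of distance j, and of pairs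
   of neighbouring places of common distance j >= 2, that occur when the gaps of
   the occupied set O are filled politely.  A gap is always split into halves
   (or filled from its end), so both are sums over the gaps of weights that
   depend only on the sizes of the gaps, and a polite choice of distance m
   lowers B_m by 1, lowers D_m by 1 if the chosen place has a "twin" (an empty
   neighbour of the same distance m >= 2), and changes nothing else.  Counting a
   place with a twin as 1/2 and the other places of maximal distance m as 1, the
   available choices add up to B_m(O).  Hence prod_j 2^D_j(O) B_j(O)! satisfies
   the recursion for the number of polite completions of O.  After the first
   choice i the gaps are those of two separate rows of i and n + 1 - i places,
   in each of which an end place is taken. *)

(** * Sums of weights over the gaps of a row given as a word *)

Section GapSums.
Variable W : bool -> nat -> nat.

(* [k] is the length of the current gap so far, and [e] tells whether this gap
   starts at the left end of the row. *)
Fixpoint gap_scan (e : bool) (k : nat) (s : seq bool) : nat :=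
  match s with
  | [::] => W true k
  | true :: s' => W e k + gap_scan false 0 s'
  | false :: s' => gap_scan e k.+1 s'
  end.

Lemma gap_scan_nseq e k m s :
  gap_scan e k (nseq m false ++ s) = gap_scan e (k + m) s.
Proof. by elim: m k => [|m IH] k /=; [rewrite addn0|rewrite IH addSnnS]. Qed.

(** An occupied place closes the current gap, so what precedes it adds a constant [c], whatever
    follows. *)
Lemma gap_scan_cat e k u :
  exists c, forall v, gap_scan e k (u ++ true :: v) = c + gap_scan false 0 v.
Proof.
elim: u e k => [|[] u IH] e k; first by exists (W e k).
  have [c Hc] := IH false 0; exists (W e k + c) => v.
  by rewrite /= Hc addnA.
by have [c Hc] := IH e k.+1; exists c.
Qed.

End GapSums.

(** Isolates the run of empty places just left of a chosen place; in the first alternative this run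
    reaches the end of the row. *)
Lemma bool_suffix (u : seq bool) : exists l,
  u = nseq l false \/ exists u', u = u' ++ true :: nseq l false.
Proof.
elim: u => [|b u [l [->|[u' ->]]]]; first by exists 0; left.
  case: b; last by exists l.+1; left.
  by exists l; right; exists [::].
by exists l; right; exists (b :: u').
Qed.

Lemma bool_prefix (u : seq bool) : exists l,
  u = nseq l false \/ exists u', u = nseq l false ++ true :: u'.
Proof.
elim: u => [|[] u [l H]]; first by exists 0; left.
  by exists 0; right; exists u.
exists l.+1; case: H => [->|[u' ->]]; first by left.
by right; exists u'.
Qed.

(** * Gap sums of a set of occupied places *)

Section Occ.
Variable n : nat.
Implicit Types (O : {set 'I_n}) (x y z : 'I_n).

Definition occ_word O : seq bool := [seq i \in O | i <- enum 'I_n].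

Definition gap_sum (W : bool -> nat -> nat) O : nat := gap_scan W true 0 (occ_word O).

Lemma size_occ_word O : size (occ_word O) = n.
Proof. by rewrite size_map size_enum_ord. Qed.

Lemma nth_occ_word O x : nth false (occ_word O) x = (x \in O).
Proof. by rewrite (nth_map x) ?size_enum_ord // nth_ord_enum. Qed.

(* [e] and [f] tell whether the gap around [x] is unbounded on the left,
   resp. on the right. *)
Lemma gap_sum_split O x : x \notin O -> exists e l f r,
  [/\ forall y, y \in O -> y + l < x \/ x + r < y,
      if e then x = l :> nat else exists2 y, y \in O & y + l.+1 = x,
      if f then x + r.+1 = n else exists2 y, y \in O & x + r.+1 = y :> nat
    & forall W, gap_sum W O + (W e l + W f r) =
                gap_sum W (x |: O) + W (e || f) (l + r).+1].
Proof.
move=> xO; set w := occ_word O.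
have xw : x < size w by rewrite size_occ_word.
set u := take x w; set v := drop x.+1 w.
have Ew : w = u ++ false :: v.
  by rewrite -[LHS](cat_take_drop x) (drop_nth false) // nth_occ_word (negPf xO).
have su : size u = x by rewrite size_takel // ltnW.
have sv : x + (size v).+1 = n.
  by move: (size_occ_word O); rewrite -/w Ew size_cat /= su.
have Ew' : occ_word (x |: O) = u ++ true :: v.
  apply: (@eq_from_nth _ false); first by rewrite size_occ_word size_cat /= su sv.
  rewrite size_occ_word => i lin.
  rewrite (nth_occ_word _ (Ordinal lin)) in_setU1 -nth_occ_word /= -/w Ew !nth_cat su -val_eqE /=.
  by case: ltngtP => [//|xi|->]; rewrite ?subnn // -(subnSK xi).
have nthO i (lin : i < n) : nth false w i -> Ordinal lin \in O.
  by rewrite (nth_occ_word O (Ordinal lin)).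
have [l Hl] := bool_suffix u; have [r Hr] := bool_prefix v.
exists (if u == nseq l false then true else false), l.
exists (if v == nseq r false then true else false), r; split.
- move=> y; rewrite -nth_occ_word -/w Ew nth_cat su; case: ltnP => [yx|xy].
    move=> H; left; case: Hl => [Eu|[u' Eu]].
      by move: H; rewrite Eu nth_nseq; case: ifP.
    move: su H; rewrite Eu size_cat /= size_nseq nth_cat => sux.
    case: ltnP => [|uy]; first by lia.
    case E: (y - size u') => [|k]; first by lia.
    by rewrite /= nth_nseq; case: ifP.
  case E: (y - x) => [|k] //= H; right; case: Hr => [Ev|[v' Ev]].
    by move: H; rewrite Ev nth_nseq; case: ifP.
  move: H; rewrite Ev nth_cat size_nseq; case: ltnP => kr.
    by rewrite nth_nseq kr.
  by lia.
- case: eqP Hl => [Eu _|ne [//|[u' Eu]]]; first by rewrite -su Eu size_nseq.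
  move: su; rewrite Eu size_cat /= size_nseq => sux.
  have lin : size u' < n by have := ltn_ord x; lia.
  exists (Ordinal lin) => //; apply: nthO.
  by rewrite Ew Eu -catA nth_cat ltnn subnn.
- case: eqP Hr => [Ev _|ne [//|[v' Ev]]]; first by move: sv; rewrite Ev size_nseq.
  move: sv; rewrite Ev size_cat /= size_nseq => svx.
  have lin : x + r.+1 < n by lia.
  exists (Ordinal lin) => //; apply: nthO.
  rewrite Ew nth_cat su (_ : x + r.+1 < x = false); last by lia.
  by rewrite addKn /= Ev nth_cat size_nseq ltnn subnn.
move=> W; rewrite /gap_sum Ew' -/w Ew.
(* The gaps beyond the one around [x] add the same [c], whether the first run of [v] is merged with
   the [k] empty places before it or stands alone. *)
have Hv e k : exists2 c, gap_scan W e k v = W (e || (v == nseq r false)) (k + r) + c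
    & gap_scan W false 0 v = W (v == nseq r false) r + c.
  case: eqP Hr => [Ev _|ne [//|[v' Ev]]].
    by exists 0; rewrite Ev -[nseq r false]cats0 !gap_scan_nseq /= ?orbT ?addn0.
  by exists (gap_scan W false 0 v'); rewrite Ev !gap_scan_nseq //= orbF.
case: eqP Hl => [Eu _|ne [//|[u' Eu]]].
  rewrite Eu !gap_scan_nseq /=; have [c -> ->] := Hv true (0 + l).+1.
  by rewrite /= add0n addSn; case: eqP => _; lia.
rewrite Eu -!catA; have [c Hc] := gap_scan_cat W true 0 u'.
rewrite !Hc !gap_scan_nseq /=; have [c' -> ->] := Hv false (0 + l).+1.
by rewrite /= add0n addSn; case: eqP => _; lia.
Qed.

Lemma gap_sum_setT W : W true 0 = 0 -> W false 0 = 0 -> gap_sum W setT = 0.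
Proof.
move=> Wt Wf; rewrite /gap_sum /occ_word.
rewrite (eq_map (g := fun=> true)); last by move=> i; rewrite inE.
suff H e (s : seq 'I_n) : gap_scan W e 0 [seq true | _ <- s] = 0 by apply: H.
by elim: s e => [|a s IH] e //=; rewrite IH; case: e; rewrite ?Wt ?Wf.
Qed.

Lemma gap_sum_set1 W x : gap_sum W [set x] = W true x + W true (n - x.+1).
Proof.
have -> : gap_sum W [set x] =
    gap_scan W true 0 (nseq x false ++ true :: nseq (n - x.+1) false).
  rewrite /gap_sum; congr gap_scan; apply: (@eq_from_nth _ false).
    rewrite size_occ_word size_cat /= !size_nseq; have := ltn_ord x; lia.
  rewrite size_occ_word => i lin.
  rewrite (nth_occ_word _ (Ordinal lin)) inE -val_eqE /= nth_cat size_nseq !nth_nseq.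
  case: ltngtP => [//|xi|->]; last by rewrite subnn.
  by rewrite -(subnSK xi) /= nth_nseq if_same.
by rewrite gap_scan_nseq /= -[nseq _ _]cats0 gap_scan_nseq /= !add0n.
Qed.

End Occ.

(** * Distances, and pairs of neighbouring places with equal distance *)

Section Distances.
Variable n : nat.
Implicit Types (O : {set 'I_n}) (x y z : 'I_n).

Lemma place_dist_le O x y : y \in O -> place_dist O x <= `|x - y|.
Proof.
move=> yO; rewrite /place_dist; have := mem_index_enum y.
elim: (index_enum _) => // a s IH; rewrite inE big_cons => /predU1P[<-|/IH ys].
  by rewrite yO geq_minl.
by case: ifP => // _; rewrite geq_min ys orbT.
Qed.

(** The bound [k <= n] reflects the default value [n] of the minimum. *)
Lemma place_dist_geP O x k :
  reflect (k <= n /\ forall y, y \in O -> k <= `|x - y|) (k <= place_dist O x).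
Proof.
apply: (iffP idP) => [kd|[kn H]].
  split=> [|y yO]; last exact: leq_trans kd (place_dist_le x yO).
  apply: leq_trans kd _; rewrite /place_dist.
  by elim/big_rec: _ => // y m _ mn; rewrite geq_min mn orbT.
by apply: (big_ind (fun m => k <= m)) => // a b ka kb; rewrite leq_min ka.
Qed.

Lemma place_dist_attained O x : O != set0 ->
  exists2 y, y \in O & place_dist O x = `|x - y|.
Proof.
case/set0Pn=> o oO; case: (@arg_minnP _ o (mem O) (fun y => `|x - y|%N) oO) => y yO miny.
exists y => //; apply/eqP; rewrite eqn_leq place_dist_le //=.
by apply/place_dist_geP; split => //; have := ltn_ord x; have := ltn_ord y; lia.
Qed.

Lemma place_dist_lt O x : O != set0 -> place_dist O x < n.
Proof.
by move=> /(place_dist_attained x)[y _ ->]; have := ltn_ord x; have := ltn_ord y; lia.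
Qed.

Lemma place_dist_gt0 O x : O != set0 -> (0 < place_dist O x) = (x \notin O).
Proof.
move=> O0; apply/idP/idP => [|xO].
  by apply: contraTN => /(place_dist_le x); rewrite distnn leqn0 => /eqP ->.
have [y yO ->] := place_dist_attained x O0.
rewrite lt0n distn_eq0; apply: contra xO => /eqP/val_inj E.
by rewrite E.
Qed.

Lemma place_dist_setU1 O x y :
  O != set0 -> place_dist (x |: O) y = minn (place_dist O y) `|y - x|.
Proof.
move=> O0; apply/eqP; rewrite eqn_leq; apply/andP; split.
  rewrite leq_min place_dist_le ?setU11 // andbT.
  by have [z zO ->] := place_dist_attained y O0; rewrite place_dist_le // setU1r.
apply/place_dist_geP; split=> [|z /setU1P[->|zO]]; last 2 first.
- exact: geq_minr.
- by rewrite geq_min place_dist_le.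
by rewrite geq_min ltnW ?place_dist_lt.
Qed.

Lemma polite_choiceP O x :
  reflect (x \notin O /\ forall y, y \notin O -> place_dist O y <= place_dist O x)
          (polite_choice O x).
Proof.
apply: (iffP andP) => -[xO H]; split=> //.
  by move=> y yO; apply: implyP yO; apply: forallP H y.
by apply/forallP => y; apply/implyP; apply: H.
Qed.

Definition twin O x z :=
  [&& (z == x.+1 :> nat) || (x == z.+1 :> nat), z \notin O & place_dist O z == place_dist O x].

Lemma twin_dist O x z : twin O x z -> `|x - z| = 1.
Proof. by case/and3P => /orP[] /eqP E _ _; lia. Qed.

Lemma twin_sym O x z : x \notin O -> twin O x z -> twin O z x.
Proof. by move=> xO /and3P[a _ b]; rewrite /twin orbC a xO eq_sym. Qed.

(** An occupied place nearest to [x] lies on its left, since one on the right would be nearer to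
    [z]; symmetrically for [z]. So twins are the two middle places of an even gap between occupied
    places. *)
Lemma twin_bounds O x z : O != set0 -> x \notin O -> twin O x z -> z = x.+1 :> nat ->
  (exists2 o, o \in O & o + place_dist O x = x) /\
  (exists2 o, o \in O & x.+1 + place_dist O x = o).
Proof.
move=> O0 xO /and3P[_ zO /eqP Ed] Ez.
have dx : 0 < place_dist O x by rewrite place_dist_gt0.
split.
  have [o oO Eo] := place_dist_attained x O0; exists o => //.
  have := place_dist_le z oO; lia.
have [o oO Eo] := place_dist_attained z O0; exists o => //.
have := place_dist_le x oO; lia.
Qed.

Lemma twin_uniq O x z z' : O != set0 -> x \notin O -> twin O x z -> twin O x z' -> z = z'.
Proof.
move=> O0 xO.
suff H u v : twin O x u -> u = x.+1 :> nat -> twin O x v -> x = v.+1 :> nat -> False.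
  move=> tz tz'; have /and3P[/orP[]/eqP E _ _] := tz;
  have /and3P[/orP[]/eqP E' _ _] := tz'; first [exact/val_inj/(etrans E)|
  by case: (H _ _ tz E tz' E')|by case: (H _ _ tz' E' tz E)|apply/val_inj => /=; lia].
(* Let [d] be the common distance. The right bound of the pair [v], [x] is the occupied place
   [x + d], which is only [d - 1] away from [u]. *)
move=> tu Eu tv Ev.
have vO : v \notin O by case/and3P: tv.
have [[o oO Eo] _] := twin_bounds O0 xO tu Eu.
have [_ [o' oO' Eo']] := twin_bounds O0 vO (twin_sym xO tv) Ev.
have /and3P[_ _ /eqP Ed] := tv.
have := place_dist_le x oO'.
have /and3P[_ _ /eqP <-] := tu.
have := place_dist_le u oO'.
have : 0 < place_dist O x by rewrite place_dist_gt0.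
have /and3P[_ _ /eqP Eux] := tu.
lia.
Qed.

(* If they were not neighbours, a place strictly between them would be farther away. *)
Lemma polite_near_twin O x y :
  O != set0 -> polite_choice O x -> y \notin O -> y != x -> place_dist O y = place_dist O x ->
  `|y - x| < place_dist O x -> twin O x y.
Proof.
move=> O0 /polite_choiceP[xO xmax] yO yx Ed lt.
rewrite /twin yO Ed eqxx andbT; apply: contraT; rewrite negb_or => /andP[n1 n2].
(* [x] and [y] are so close that no occupied place lies between them; the one nearest to [c] is
   beyond [x] or [y], hence farther from [c]. *)
have dmid (c : 'I_n) : minn x y < c < maxn x y -> place_dist O x < place_dist O c.
  move=> Hc; have [o oO ->] := place_dist_attained c O0.
  have := place_dist_le x oO; have := place_dist_le y oO; lia.
have dc (c : 'I_n) : minn x y < c < maxn x y -> False.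
  move=> /dmid Hc; have cO : c \notin O by rewrite -place_dist_gt0 //; lia.
  by have := xmax _ cO; lia.
have /negP ne : ~~ (y == x :> nat) by [].
have lc : (minn x y).+1 < n by have := ltn_ord x; have := ltn_ord y; lia.
by case: (dc (Ordinal lc)) => /=; lia.
Qed.

End Distances.

(** * Weights of gaps and their change under a polite choice *)

Section GapWeights.

Section Fuel.
Variable T : bool -> nat -> nat.

(** Taking a middle place of an inner gap leaves two halves. This recursion is not structural in
    [g], so [k] bounds its depth; any [k >= g] gives the same value. *)
Fixpoint fuelled_weight (k g : nat) : nat :=
  if k is k'.+1 then
    if g is g'.+1 then
      T false g + (fuelled_weight k' g'./2 + fuelled_weight k' (uphalf g'))
    else 0
  else 0.

Lemma fuelled_weight_stable k k' g :
  g <= k -> g <= k' -> fuelled_weight k g = fuelled_weight k' g.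
Proof.
elim: k k' g => [|k IH] [|k'] [|g] //= gk gk'.
by rewrite !(IH k') //; lia.
Qed.

(* The total of [T] over all gaps that arise while a gap of size [g] is filled
   politely; the gap touches an end of the row if [e] holds. *)
Definition gap_weight (e : bool) (g : nat) : nat :=
  if g is g'.+1 then
    if e then T true g + fuelled_weight g' g' else fuelled_weight g g
  else 0.

Lemma gap_weight_end g : gap_weight true g.+1 = T true g.+1 + gap_weight false g.
Proof. by case: g. Qed.

Lemma gap_weight_inner g : gap_weight false g.+1 =
  T false g.+1 + (gap_weight false g./2 + gap_weight false (uphalf g)).
Proof.
have H h : gap_weight false h = fuelled_weight h h by case: h.
rewrite !H /= (@fuelled_weight_stable g g./2) ?(@fuelled_weight_stable g (uphalf g)) //; lia.
Qed.

Lemma gap_weight0 e : gap_weight e 0 = 0. Proof. by []. Qed.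

End Fuel.

Arguments gap_weight : simpl never.

Variable n : nat.
Implicit Types (O : {set 'I_n}) (x y z : 'I_n).

(** Maximality forces [x] to the outer end of an end gap or to a middle place of an inner gap, which
    is the splitting built into [gap_weight]. The same [e] and [g] serve all weights [T], so
    distances and twins are tracked together. *)
Lemma polite_gap O x : O != set0 -> polite_choice O x -> exists e g,
  [/\ forall T, gap_sum (gap_weight T) O = gap_sum (gap_weight T) (x |: O) + T e g,
      place_dist O x = (if e then g else uphalf g)
    & [exists z, twin O x z] = ~~ e && ~~ odd g].
Proof.
move=> O0 /polite_choiceP[xO xmax].
have [e [l [f [r [HO He Hf HW]]]]] := gap_sum_split xO.
have dist_ge y k : (forall o, o \in O -> k <= `|y - o|) -> k <= place_dist O y.
  by move=> H; have [o oO ->] := place_dist_attained y O0; apply: H.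
have dist_le y k : (exists2 o, o \in O & `|y - o| <= k) -> place_dist O y <= k.
  by case=> o oO; apply: leq_trans; apply: place_dist_le.
have far y k : y != x -> place_dist O x < k -> (forall o, o \in O -> k <= `|y - o|) -> False.
  move=> yx xk /dist_ge dy.
  have yO : y \notin O by rewrite -place_dist_gt0 //; lia.
  by have := xmax y yO; lia.
have dx1 : 0 < place_dist O x by rewrite place_dist_gt0.
have xn := ltn_ord x.
(* [twin_bounds] puts occupied places on both sides of [x], at distances that differ by one. *)
have twinN : [exists z, twin O x z] -> (e || f = false) /\ l <> r.
  case/existsP => z tz; have /and3P[adj zO /eqP Edz] := tz.
  have zn := ltn_ord z.
  case/orP: adj => /eqP Ez.
    have [[o oO Eo] [o' oO' Eo']] := twin_bounds O0 xO tz Ez.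
    have := HO _ oO; have := HO _ oO'.
    case: (e) He => [|[a aO Ea]]; first by lia.
    case: (f) Hf => [|[b bO Eb]]; first by have := ltn_ord o'; lia.
    have := place_dist_le x aO; have := place_dist_le z bO; split=> //; lia.
  have [[o oO Eo] [o' oO' Eo']] := twin_bounds O0 zO (twin_sym xO tz) Ez.
  have := HO _ oO; have := HO _ oO'.
  case: (e) He => [|[a aO Ea]]; first by lia.
  case: (f) Hf => [|[b bO Eb]]; first by have := ltn_ord o'; lia.
  have := place_dist_le z aO; have := place_dist_le x bO; split=> //; lia.
case: e He HW twinN => [El|[a aO Ea]]; case: f Hf => [Er|[b bO Eb]] HW twinN.
- by have [o oO] := set0Pn _ O0; have := HO _ oO; have := ltn_ord o; lia.
- have dx : place_dist O x = r.+1.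
    apply/eqP; rewrite eqn_leq dist_le; last by exists b => //; lia.
    by apply: dist_ge => o oO; have := HO _ oO; lia.
  (* In an end gap, a place further out than [x] would have a larger distance. *)
  have l0 : l = 0.
    apply/eqP; apply: contraT => l0.
    have lc : x.-1 < n by lia.
    case: (far (Ordinal lc) r.+2) => [||o oO]; rewrite ?dx //=.
      by apply/eqP => /(congr1 val) /=; lia.
    by have := HO _ oO; lia.
  exists true, r.+1; rewrite dx; split=> //; last by apply: contraTF isT => /twinN [].
  move=> T; have := HW (gap_weight T).
  by rewrite l0 /= add0n gap_weight_end gap_weight0; lia.
- have dx : place_dist O x = l.+1.
    apply/eqP; rewrite eqn_leq dist_le; last by exists a => //; lia.
    by apply: dist_ge => o oO; have := HO _ oO; have := ltn_ord o; lia.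
  have r0 : r = 0.
    apply/eqP; apply: contraT => r0.
    have lc : x.+1 < n by lia.
    case: (far (Ordinal lc) l.+2) => [||o oO]; rewrite ?dx //=.
      by apply/eqP => /(congr1 val) /=; lia.
    by have := HO _ oO; have := ltn_ord o; lia.
  exists true, l.+1; rewrite dx; split=> //; last by apply: contraTF isT => /twinN [].
  move=> T; have := HW (gap_weight T).
  by rewrite r0 /= addn0 gap_weight_end gap_weight0; lia.
have dx : place_dist O x = (minn l r).+1.
  apply/eqP; rewrite eqn_leq; apply/andP; split.
    by case: (leqP l r) => lr; apply: dist_le; [exists a|exists b] => //; lia.
  by apply: dist_ge => o oO; have := HO _ oO; lia.
(* If the two sides of an inner gap differ by more than one, moving one step towards the longer side
   increases the distance. *)
have lr : l <= r.+1.
  rewrite leqNgt; apply/negP => lr.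
  have lc : x.-1 < n by lia.
  case: (far (Ordinal lc) r.+2) => [||o oO]; rewrite ?dx //=.
  - by apply/eqP => /(congr1 val) /=; lia.
  - by lia.
  - by have := HO _ oO; lia.
have rl : r <= l.+1.
  rewrite leqNgt; apply/negP => rl.
  have lc : x.+1 < n by have := ltn_ord b; lia.
  case: (far (Ordinal lc) l.+2) => [||o oO]; rewrite ?dx //=.
  - by apply/eqP => /(congr1 val) /=; lia.
  - by lia.
  - by have := HO _ oO; lia.
exists false, (l + r).+1; split.
- move=> T; have := HW (gap_weight T); rewrite /= gap_weight_inner.
  have [[-> ->]|[-> ->]] : (l + r)./2 = l /\ uphalf (l + r) = r \/
      (l + r)./2 = r /\ uphalf (l + r) = l.
  + by lia.
  + by lia.
  + by lia.
- by rewrite dx; lia.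
rewrite /= negbK; apply/idP/idP => [/twinN[_ ne]|od]; first by lia.
(* The twin is the neighbour of [x] on the longer side. *)
apply/existsP; have /orP[/eqP E|/eqP E] : (r == l.+1) || (l == r.+1) by lia.
- have lc : x.+1 < n by have := ltn_ord b; lia.
  exists (Ordinal lc); apply/and3P; split => /=.
  + by rewrite eqxx.
  + by apply/negP => /HO /=; lia.
  rewrite dx eqn_leq; apply/andP; split.
    by apply: dist_le; exists b => //=; lia.
  by apply: dist_ge => o /HO /=; lia.
- have lc : x.-1 < n by lia.
  exists (Ordinal lc); apply/and3P; split => /=.
  + by apply/orP; right; apply/eqP; lia.
  + by apply/negP => /HO /=; lia.
  rewrite dx eqn_leq; apply/andP; split.
    by apply: dist_le; exists a => //=; lia.
  by apply: dist_ge => o /HO /=; lia.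
Qed.

(** This is B_j: the place taken has distance [g] in an end gap of size [g], and [uphalf g] in an
    inner one. *)
Definition bsum j O : nat :=
  gap_sum (gap_weight (fun e g => (if e then g else uphalf g) == j)) O.

(** This is D_j: twins of distance [j] are the middle of an inner gap of size [2 * j]. The test
    [1 < j] encodes the convention for distance 1. *)
Definition dsum j O : nat :=
  gap_sum (gap_weight (fun e g => [&& 1 < j, ~~ e & g == j.*2])) O.

Lemma bsum_polite j O x : O != set0 -> polite_choice O x ->
  bsum j O = bsum j (x |: O) + (place_dist O x == j).
Proof. by move=> O0 /(polite_gap O0)[e [g [HW -> _]]]; apply: HW. Qed.

Lemma dsum_polite j O x : O != set0 -> polite_choice O x ->
  dsum j O = dsum j (x |: O) +
    [&& 1 < j, place_dist O x == j & [exists z, twin O x z]].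
Proof.
move=> O0 /(polite_gap O0)[e [g [HW -> ->]]]; rewrite {1}/dsum HW.
congr (_ + nat_of_bool (_ && _)); case: (e) => /=; first by rewrite andbF.
by apply/eqP/andP => [->|[/eqP]]; [split|]; lia.
Qed.

Lemma bsum_setT j : bsum j [set: 'I_n] = 0.
Proof. exact: gap_sum_setT. Qed.

Lemma dsum_setT j : dsum j [set: 'I_n] = 0.
Proof. exact: gap_sum_setT. Qed.

End GapWeights.

(** * The recursion for the product formula *)

Section PoliteStep.
Variable n : nat.
Implicit Types (O : {set 'I_n}) (x y z : 'I_n).

(** Backward induction along a polite filling: some polite choice exists as long as a place is
    empty. *)
Lemma polite_ind (P : {set 'I_n} -> Prop) :
  P setT ->
  (forall O x, O != set0 -> polite_choice O x -> P (x |: O) -> P O) ->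
  forall O, O != set0 -> P O.
Proof.
move=> PT PS O; have [k] := ubnP (n - #|O|); elim: k O => // k IH O Ok O0.
have : #|O| <= n by rewrite -[leqRHS]card_ord max_card.
rewrite leq_eqVlt => /orP[/eqP On|On].
  suff -> : O = setT by [].
  by apply/eqP; rewrite eqEcard subsetT cardsT card_ord On /=.
have [x Px] := polite_choice_exists On.
apply: (PS O x) => //; apply: IH; last by apply/set0Pn; exists x; rewrite setU11.
by rewrite cardsU1; case/polite_choiceP: Px => -> _; lia.
Qed.

Lemma dsum_small j O : O != set0 -> j <= 1 -> dsum j O = 0.
Proof.
move=> O0 j1; elim/polite_ind: O / O0 => [|O x O0 Px IH]; first exact: dsum_setT.
by rewrite (dsum_polite j O0 Px) IH ltnNge j1.
Qed.

Lemma twinE O x z m : O != set0 -> 0 < m -> place_dist O x = m ->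
  twin O x z = ((z == x.+1 :> nat) || (x == z.+1 :> nat)) && (place_dist O z == m).
Proof.
move=> O0 + Em; rewrite -Em /twin => m0; case: (_ || _) => //=.
by case: eqP => [E|]; rewrite ?andbF // andbT -place_dist_gt0 // E m0.
Qed.

Section MaxStep.
Variables (O : {set 'I_n}) (x : 'I_n).
Hypotheses (O0 : O != set0) (Px : polite_choice O x).
Let m := place_dist O x.

Let xO : x \notin O. Proof. by case/polite_choiceP: Px. Qed.
Let m0 : 0 < m. Proof. by rewrite place_dist_gt0. Qed.
Let xO0 : x |: O != set0. Proof. by apply/set0Pn; exists x; rewrite setU11. Qed.

(** A place whose distance drops below [m] is nearer than [m] to [x], so it is [x] or its twin by
    [polite_near_twin]. For [m = 1] the twin, one step away, keeps its distance. *)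
Lemma max_dist_setU1 y : (place_dist (x |: O) y == m) =
  [&& place_dist O y == m, y != x & ~~ ((1 < m) && twin O x y)].
Proof.
rewrite place_dist_setU1 //; apply/eqP/and3P => [E|[/eqP E yx nt]].
  have yO : y \notin O by rewrite -place_dist_gt0 //; lia.
  have /polite_choiceP[_ /(_ _ yO)] := Px; rewrite -/m => ym.
  split; first by apply/eqP; lia.
    by apply/eqP => yx; move: E; rewrite yx distnn; lia.
  by apply/negP => /andP[m1 /twin_dist]; lia.
rewrite E; suff : m <= `|y - x| by lia.
rewrite leqNgt; apply: contra nt => lt.
have yO : y \notin O by rewrite -place_dist_gt0 //; lia.
apply/andP; split; last exact: polite_near_twin.
have /negP ne : ~~ (y == x :> nat) by [].
lia.
Qed.

(** If [y] lost its twin [z], then [z] would be [x] or the twin of [x]; uniqueness of twins then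
    makes [y] the twin of [x] or [x] itself. *)
Lemma has_twin_setU1 y : 1 < m -> place_dist (x |: O) y = m ->
  [exists z, twin (x |: O) y z] = [exists z, twin O y z].
Proof.
move=> m1 E; have /and3P[/eqP Ey yx nt] : [&& place_dist O y == m, y != x &
  ~~ ((1 < m) && twin O x y)] by rewrite -max_dist_setU1 E.
have yO : y \notin O by rewrite -place_dist_gt0 // Ey.
apply: eq_existsb => z; rewrite (twinE z xO0 m0 E) max_dist_setU1 m1 /= in nt *.
apply/idP/idP => [/and4P[a b _ _]|tz].
  by rewrite (twinE z O0 m0 Ey) a.
have zO : z \notin O by case/and3P: tz.
move: (tz); rewrite (twinE z O0 m0 Ey) => /andP[-> ->] /=.
apply/andP; split.
  by apply: contraNneq nt => <-; apply: twin_sym.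
apply: contraNN yx => tx; apply/eqP.
exact: (twin_uniq O0 zO (twin_sym yO tz) (twin_sym xO tx)).
Qed.

End MaxStep.

(* A pair of twins is a single slot for either of its places, so each of them
   counts one half; the weights are doubled to stay in [nat]. *)
Definition choice_weight O x : nat :=
  if (1 < place_dist O x) && [exists z, twin O x z] then 1 else 2.

(** A polite choice of distance [m] lowers both sides by 2: either one place of weight 2 disappears,
    or two twins of weight 1 do. If the maximal distance is below [m], no place has distance [m]
    before or after the choice. *)
Lemma sum_choice_weight m O : O != set0 -> 0 < m ->
  (forall y, place_dist O y <= m) ->
  \sum_(y | place_dist O y == m) choice_weight O y = 2 * bsum m O.
Proof.
move=> O0 m0; elim/polite_ind: O / O0 => [|O x O0 Px IH] Om.
  rewrite bsum_setT big1 // => y /eqP Ey.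
  have T0 : [set: 'I_n] != set0 by apply/set0Pn; exists y.
  by have := place_dist_gt0 y T0; rewrite inE Ey m0.
have xO : x \notin O by case/polite_choiceP: Px.
have dO' y := place_dist_setU1 x y O0.
have {}IH := IH (fun y => leq_trans (eq_leq (dO' y)) (leq_trans (geq_minl _ _) (Om y))).
rewrite (bsum_polite m O0 Px) mulnDr -{}IH.
have [Ex|nx] := eqVneq (place_dist O x) m; last first.
  have xmax y : place_dist O y < m.
    have [yO|yO] := boolP (y \in O).
      by rewrite (leq_ltn_trans _ m0) // leqNgt place_dist_gt0 // yO.
    have /polite_choiceP[_ /(_ _ yO)] := Px.
    by move/leq_ltn_trans; apply; rewrite ltn_neqAle nx Om.
  rewrite !big_pred0 // => y; first by rewrite dO'; have := xmax y; lia.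
  by have := xmax y; lia.
have Pm y := max_dist_setU1 O0 Px y; rewrite Ex in Pm.
have Pt y (H : 1 < m) := @has_twin_setU1 _ _ O0 Px y; rewrite Ex in Pt.
have -> : \sum_(y | place_dist (x |: O) y == m) choice_weight (x |: O) y =
    \sum_(y | [&& place_dist O y == m, y != x & ~~ ((1 < m) && twin O x y)])
      choice_weight O y.
  apply: eq_big => [//|y Ey]; rewrite /choice_weight (eqP Ey).
  move: (Ey); rewrite Pm => /andP[/eqP -> _].
  by case: ltnP => //= m1; rewrite Pt //; apply/eqP.
rewrite (bigD1 x) ?Ex //= {1}/choice_weight Ex.
case: (boolP (1 < m)) => m1 /=; last first.
  rewrite addnC; congr (_ + _).
  by apply: eq_bigl => y; rewrite andbT.
case: existsP => [[z tz]|nt]; last first.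
  rewrite addnC; congr (_ + _); apply: eq_bigl => y.
  by case: (boolP (twin O x y)) => [ty|_]; [case: nt; exists y|rewrite andbT].
have zO : z \notin O by case/and3P: tz.
have /and3P[_ _ /eqP Ez] := tz; rewrite Ex in Ez.
have zx : z != x by apply/eqP => Ezx; have := twin_dist tz; rewrite Ezx distnn.
rewrite (bigD1 z) ?Ez ?eqxx //= {1}/choice_weight Ez m1 /=.
have -> : [exists z0, twin O z z0] by apply/existsP; exists x; apply: twin_sym.
rewrite addnA addnC; congr (_ + _); apply: eq_bigl => y; rewrite -andbA.
congr [&& _, _ & ~~ _]; apply/eqP/idP => [->//|ty].
exact: (twin_uniq O0 xO ty tz).
Qed.

Definition completion_count O : nat :=
  \prod_(1 <= j < n) (2 ^ dsum j O * (bsum j O)`!).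

(** Only the factor of the distance of [x] changes: the factorial loses its top factor, and the
    power of 2 is halved exactly when [x] has weight 1. *)
Lemma completion_count_step O x : O != set0 -> polite_choice O x ->
  completion_count O * choice_weight O x =
  2 * bsum (place_dist O x) O * completion_count (x |: O).
Proof.
move=> O0 Px; set k := place_dist O x.
have k0 : 0 < k by rewrite place_dist_gt0 //; case/polite_choiceP: Px.
have kn : k < n by apply: place_dist_lt.
have kin : k \in index_iota 1 n by rewrite mem_index_iota k0.
rewrite /completion_count !(bigD1_seq k) ?iota_uniq //=.
have -> : \prod_(1 <= j < n | j != k) (2 ^ dsum j O * (bsum j O)`!) =
    \prod_(1 <= j < n | j != k) (2 ^ dsum j (x |: O) * (bsum j (x |: O))`!).
  apply: eq_bigr => j jk.
  rewrite (dsum_polite j O0 Px) (bsum_polite j O0 Px) -/k.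
  by rewrite eq_sym (negPf jk) andbF !addn0.
rewrite (dsum_polite k O0 Px) (bsum_polite k O0 Px) /choice_weight -/k eqxx /=.
rewrite addn1 factS; case: (_ && _) => /=; rewrite ?addn1 ?addn0 ?expnS; nia.
Qed.

Lemma completion_count_sum O : O != set0 -> #|O| < n ->
  \sum_(x | polite_choice O x) completion_count (x |: O) = completion_count O.
Proof.
move=> O0 /polite_choice_exists[x0 P0]; set k := place_dist O x0.
have [x0O x0max] := polite_choiceP _ _ P0.
have k0 : 0 < k by rewrite place_dist_gt0.
have Pk x : polite_choice O x = (place_dist O x == k).
  apply/polite_choiceP/eqP => [[xO xmax]|Ex].
    by apply/eqP; rewrite eqn_leq x0max //= xmax.
  by rewrite Ex -place_dist_gt0 // Ex; split.
have b0 : 0 < 2 * bsum k O by rewrite (bsum_polite k O0 P0) eqxx addn1.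
(* After multiplication by [2 * bsum k O] each summand becomes [completion_count O] times the weight
   of the choice. *)
apply/eqP; rewrite -(eqn_pmul2l b0) big_distrr /=; apply/eqP.
rewrite -[in RHS]sum_choice_weight //; last first.
  move=> y; have [yO|] := boolP (y \in O); last exact: x0max.
  by have := place_dist_gt0 y O0; rewrite yO; lia.
rewrite [RHS]mulnC big_distrr /=; apply: eq_big => // x Px.
by rewrite completion_count_step //; move: Px; rewrite Pk => /eqP ->.
Qed.

End PoliteStep.

(** * Counting polite fillings by their prefixes *)

Section Fillings.
Variable n : nat.
Implicit Types (s : seq 'I_n) (x : n.-tuple 'I_n).

Definition polite_prefix s : Prop :=
  uniq s /\ forall (z0 : 'I_n) t, 0 < t < size s ->
    polite_choice [set y in take t s] (nth z0 s t).

Lemma polite_fillingP x : reflect (polite_prefix x) (polite_filling x).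
Proof.
apply: (iffP andP) => -[ux H]; split=> //.
  move=> z0 t; rewrite size_tuple => /andP[t0 tn].
  have := implyP (forallP H (Ordinal tn)) t0.
  by rewrite occupiedE (tnth_nth z0).
apply/forallP => t; apply/implyP => t0.
rewrite occupiedE (tnth_nth t); apply: H.
by rewrite t0 size_tuple ltn_ord.
Qed.

Lemma polite_prefix_rcons s z : s != [::] -> polite_prefix s ->
  polite_choice [set y in s] z -> polite_prefix (rcons s z).
Proof.
move=> s0 [us Hs] Pz; split.
  by rewrite rcons_uniq us andbT; case/polite_choiceP: Pz; rewrite inE.
move=> z0 t /andP[t0]; rewrite size_rcons ltnS leq_eqVlt => /predU1P[->|ts].
  by rewrite nth_rcons ltnn eqxx -cats1 take_size_cat.
rewrite nth_rcons ts -cats1 takel_cat 1?ltnW //.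
by apply: Hs; rewrite t0.
Qed.

Definition completions s : nat :=
  #|[set x : n.-tuple 'I_n | polite_filling x && (take (size s) x == s)]|.

Lemma completions_rcons s :
  size s < n -> completions s = \sum_z completions (rcons s z).
Proof.
move=> sn; rewrite /completions -sum1_card.
rewrite (partition_big (fun x => tnth x (Ordinal sn)) predT) //=.
apply: eq_bigr => z _; rewrite -sum1_card; apply: eq_bigl => x.
rewrite !inE -andbA; congr (_ && _).
by rewrite size_rcons (take_nth z) ?size_tuple // eqseq_rcons (tnth_nth z).
Qed.

(** Both sides are 1 for a full row. Otherwise both are sums over the next place, where an impolite
    place has no completion. *)
Lemma completions_count s : s != [::] -> polite_prefix s ->
  completions s = completion_count [set y in s].
Proof.
have [k] := ubnP (n - size s); elim: k s => // k IH s sk s0 Ps.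
have us : uniq s by case: Ps.
have cs : #|[set y in s]| = size s by rewrite cardsE (card_uniqP us).
have O0 : [set y in s] != set0 by rewrite -card_gt0 cs lt0n size_eq0.
have : size s <= n by rewrite -cs -[leqRHS]card_ord max_card.
rewrite leq_eqVlt => /orP[/eqP sn|sn].
  have -> : [set y in s] = setT.
    by apply/eqP; rewrite eqEcard subsetT cardsT card_ord cs sn /=.
  rewrite /completion_count big1 => [|j _]; last by rewrite dsum_setT bsum_setT.
  have ss : size s == n by apply/eqP.
  rewrite /completions (_ : [set x | _] = [set Tuple ss]) ?cards1 //.
  apply/setP=> x; rewrite !inE sn take_oversize ?size_tuple //.
  apply/andP/eqP => [[_ /eqP Ex]|->]; first exact: val_inj.
  by split=> //; apply/polite_fillingP.
rewrite completions_rcons // -completion_count_sum ?cs // [RHS]big_mkcond /=.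
apply: eq_bigr => z _; case: ifP => [Pz|nPz].
  rewrite IH; first 1 last.
  - by rewrite size_rcons; lia.
  - by rewrite -size_eq0 size_rcons.
  - exact: polite_prefix_rcons.
  by congr completion_count; apply/setP => y; rewrite !inE mem_rcons inE.
apply/eqP; rewrite cards_eq0; apply/eqP/setP => x; rewrite !inE.
apply/negP => /andP[/polite_fillingP[_ Hx]].
rewrite size_rcons (take_nth z) ?size_tuple // eqseq_rcons => /andP[/eqP Es /eqP Ez].
have := Hx z (size s); rewrite Es Ez nPz size_tuple sn andbT lt0n size_eq0.
by move=> /(_ s0).
Qed.

Lemma a_num_sum : 0 < n -> a_num n = \sum_(z : 'I_n) completion_count [set z].
Proof.
move=> n0; have -> : a_num n = completions [::].
  by rewrite /a_num /completions; apply: eq_card => x; rewrite !inE take0 andbT.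
rewrite completions_rcons //; apply: eq_bigr => z _.
rewrite completions_count //=; last by split=> // z0 [|[]].
by congr completion_count; apply/setP => y; rewrite !inE.
Qed.

(** * Reading off b and d from a single filling *)

Section OneFilling.
Variable x : n.-tuple 'I_n.
Hypothesis Px : polite_filling x.

Lemma occupiedS (t : 'I_n) : occupied x t.+1 = tnth x t |: occupied x t.
Proof.
apply/setP=> y; rewrite !occupiedE !inE (take_nth y) ?size_tuple //.
by rewrite mem_rcons inE (tnth_nth y).
Qed.

Lemma occupied_gt0 t : 0 < t -> 0 < n -> occupied x t != set0.
Proof.
move=> t0 n0; apply/set0Pn; exists (tnth x (Ordinal n0)).
by apply/imsetP; exists (Ordinal n0); rewrite ?inE.
Qed.

Lemma occupied_size : occupied x n = setT.
Proof.
have [/card_uniqP ux _] := polite_fillingP x Px.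
apply/eqP; rewrite eqEcard subsetT cardsT card_ord occupiedE cardsE.
by rewrite take_oversize ?size_tuple // ux size_tuple /=.
Qed.

Lemma polite_occupied (t : 'I_n) : 0 < t -> polite_choice (occupied x t) (tnth x t).
Proof. by case/andP: Px => _ /forallP/(_ t)/implyP. Qed.

Lemma b_num_occupied j t : 0 < t <= n ->
  #|[set u : 'I_n | (t <= u) && (place_dist (occupied x u) (tnth x u) == j)]| =
  bsum j (occupied x t).
Proof.
move=> /andP[t0 tn]; have [k] := ubnP (n - t); elim: k t t0 tn => // k IH t t0 tn tk.
move: (tn); rewrite leq_eqVlt => /orP[/eqP->|lt].
  rewrite occupied_size bsum_setT; apply/eqP; rewrite cards_eq0.
  by apply/eqP/setP => u; rewrite !inE leqNgt ltn_ord.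
pose u := Ordinal lt.
have O0 : occupied x t != set0 by rewrite occupied_gt0 // (leq_trans t0).
rewrite (bsum_polite j O0 (polite_occupied (t := u) t0)) -(occupiedS u).
rewrite -IH //=; last by lia.
rewrite (cardsD1 u) inE /= leqnn /= addnC; congr (_ + _).
apply: eq_card => v; rewrite !inE -val_eqE /= andbA; congr (_ && _).
by rewrite ltn_neqAle eq_sym.
Qed.

Lemma d_num_occupied j t : 1 < j -> 0 < t <= n ->
  #|[set P : {set 'I_n} | neighbours P &&
      [exists u : 'I_n, [&& t <= u, [disjoint P & occupied x u] &
            [forall z in P, place_dist (occupied x u) z == j]]]]| =
  dsum j (occupied x t).
Proof.
move=> j1 /andP[t0 tn]; have [k] := ubnP (n - t); elim: k t t0 tn => // k IH t t0 tn tk.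
have n0 : 0 < n by apply: leq_trans tn.
have dP u (P : {set 'I_n}) : 0 < u -> [forall z in P, place_dist (occupied x u) z == j] ->
    [disjoint P & occupied x u].
  move=> u0 /forall_inP H; rewrite disjoint_subset; apply/subsetP => y /H /eqP Ey.
  by rewrite inE -place_dist_gt0 ?occupied_gt0 // Ey; lia.
move: (tn); rewrite leq_eqVlt => /orP[/eqP->|lt].
  rewrite occupied_size dsum_setT; apply/eqP; rewrite cards_eq0.
  apply/eqP/setP => P; rewrite !inE; apply/negP => /andP[_ /existsP[u /andP[]]].
  by rewrite leqNgt ltn_ord.
set O := occupied x t; pose u := Ordinal lt; set a := tnth x u.
have O0 : O != set0 by rewrite occupied_gt0.
have Pa : polite_choice O a := polite_occupied (t := u) t0.
have [aO amax] := polite_choiceP _ _ Pa.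
rewrite (dsum_polite j O0 Pa) -(occupiedS u) -IH //=; last by lia.
(* [A] collects the pairs seen from time [t] on, [B] those from [t.+1] on. They can differ only in a
   pair containing the place [a] taken at time [t]. *)
set A := [set P | _]; set B := [set P | _].
have BA : B \subset A.
  apply/subsetP => P; rewrite !inE => /andP[-> /existsP[v /and3P[tv H1 H2]]] /=.
  by apply/existsP; exists v; rewrite (ltnW tv) H1.
have aB (P : {set 'I_n}) : a \in P -> P \notin B.
  move=> aP; rewrite inE; apply/negP => /andP[_ /existsP[v /and3P[tv]]].
  move/pred0P/(_ a); rewrite /= aP /= => /negP[].
  by apply/imsetP; exists u; rewrite ?inE.
have AB (P : {set 'I_n}) : P \in A -> P \notin B ->
    exists y z, [/\ P = [set y; z], z = y.+1 :> nat, place_dist O y = j & place_dist O z = j].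
  rewrite inE => /andP[nP /existsP[v /and3P[tv H1 H2]]] PB.
  have Ev : v = t :> nat.
    apply/eqP; rewrite eqn_leq tv andbT leqNgt; apply: contra PB => tv'.
    by rewrite inE nP; apply/existsP; exists v; rewrite tv' H1.
  have /existsP[y /existsP[z /andP[/eqP Ez /eqP EP]]] := nP.
  move/forall_inP: H2; rewrite Ev EP => H2.
  by exists y, z; split=> //; apply/eqP; apply: H2; rewrite !inE eqxx ?orbT.
have tw (y z : 'I_n) : z = y.+1 :> nat -> place_dist O y = j -> place_dist O z = j -> twin O y z.
  by move=> Ez Ey Ed; rewrite (twinE z O0 (ltnW j1) Ey) Ed Ez !eqxx.
have inA (y z : 'I_n) : z = y.+1 :> nat -> place_dist O y = j -> place_dist O z = j ->
    [set y; z] \in A.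
  move=> Ez Ey Ed; rewrite inE; apply/andP; split.
    by apply/existsP; exists y; apply/existsP; exists z; rewrite Ez !eqxx.
  have H : [forall z0 in [set y; z], place_dist O z0 == j].
    by apply/forall_inP => w /set2P[]->; apply/eqP.
  by apply/existsP; exists u; rewrite leqnn H dP.
(* Such a pair is the middle of a gap of size [2 * j]. Since [a] has distance at least [j] and
   avoids the pair, it lies outside this gap, so the pair keeps its distances. *)
have AaB (P : {set 'I_n}) : P \in A -> a \notin P -> P \in B.
  move=> PA aP; apply: contraT => PB.
  have [y [z [EP Ez Ey Ed]]] := AB P PA PB.
  have yO : y \notin O by rewrite -place_dist_gt0 // Ey; lia.
  have zO : z \notin O by rewrite -place_dist_gt0 // Ed; lia.
  have [[o oO Eo] [o' oO' Eo']] := twin_bounds O0 yO (tw _ _ Ez Ey Ed) Ez.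
  have ja : j <= place_dist O a by rewrite -Ey amax.
  have lo := place_dist_le a oO; have lo' := place_dist_le a oO'.
  move: aP; rewrite EP !inE negb_or -!val_eqE /= => /andP[/negP ay /negP az].
  have Ey' : place_dist (occupied x t.+1) y = j.
    by rewrite (occupiedS u) -/a place_dist_setU1 // Ey; lia.
  have Ez' : place_dist (occupied x t.+1) z = j.
    by rewrite (occupiedS u) -/a place_dist_setU1 // Ed; lia.
  have O1 : occupied x t.+1 != set0 by apply: occupied_gt0.
  have lt1 : t.+1 < n.
    rewrite ltn_neqAle lt andbT; apply/eqP => tn1.
    by have := place_dist_gt0 y O1; rewrite Ey' tn1 occupied_size inE; lia.
  have nP : neighbours P.
    by rewrite EP; apply/existsP; exists y; apply/existsP; exists z; rewrite Ez !eqxx.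
  have H : [forall z0 in P, place_dist (occupied x t.+1) z0 == j].
    by rewrite EP; apply/forall_inP => w /set2P[]->; apply/eqP.
  move/negP: PB; case; rewrite inE nP; apply/existsP; exists (Ordinal lt1).
  by rewrite leqnn H dP.
(* The only pair that can be lost consists of [a] and its unique twin [b]. *)
case: (boolP (_ && _)) => [/and3P[_ /eqP Ea /existsP[b tb]]|nt]; last first.
  rewrite addn0; apply: eq_card => P; apply/idP/idP => [PA|/(subsetP BA)//].
  have [aP|] := boolP (a \in P); last exact: AaB.
  have [y [z [EP Ez Ey Ed]]] := AB P PA (aB P aP).
  have tyz := tw _ _ Ez Ey Ed.
  have yO : y \notin O by rewrite -place_dist_gt0 // Ey; lia.
  case/negP: nt; rewrite j1 /=; move: aP; rewrite EP !inE => /orP[]/eqP ->.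
    by rewrite Ey eqxx; apply/existsP; exists z.
  by rewrite Ed eqxx; apply/existsP; exists y; apply: twin_sym.
have bO : b \notin O by case/and3P: tb.
have Eb : place_dist O b = j by case/and3P: tb => _ _ /eqP ->.
have abA : [set a; b] \in A.
  case/and3P: (tb) => /orP[] /eqP E _ _; first exact: inA.
  by rewrite setUC; apply: inA.
suff -> : A = [set a; b] |: B by rewrite cardsU1 aB ?set21 // addnC.
apply/setP => P; apply/idP/setU1P => [PA|[->//|/(subsetP BA)//]].
have [aP|] := boolP (a \in P); last by right; apply: AaB.
have [y [z [EP Ez Ey Ed]]] := AB P PA (aB P aP); left.
have tyz := tw _ _ Ez Ey Ed.
have yO : y \notin O by rewrite -place_dist_gt0 // Ey; lia.
rewrite EP in aP *; case/set2P: aP => E.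
  by rewrite E in tb *; rewrite (twin_uniq O0 yO tyz tb).
rewrite -E in tyz *; rewrite setUC.
by rewrite (twin_uniq O0 aO (twin_sym yO tyz) tb).
Qed.

Hypotheses (Hx : starts_leftmost x) (n0 : 0 < n).

Lemma occupied_leftmost : occupied x 1 = [set Ordinal n0].
Proof.
rewrite (occupiedS (Ordinal n0)) occupiedE take0.
have /eqP x0 : tnth x (Ordinal n0) == 0 :> nat by have /forallP/(_ (Ordinal n0)) := Hx.
apply/setP => y; rewrite !inE orbF; congr (_ == _); exact: val_inj.
Qed.

Lemma b_num_leftmost j : b_num x j = bsum j [set Ordinal n0].
Proof. by rewrite -occupied_leftmost -b_num_occupied. Qed.

Lemma d_num_leftmost j : 0 < j -> d_num x j = dsum j [set Ordinal n0].
Proof.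
move=> j0; rewrite /d_num -occupied_leftmost; case: eqP => [->|j1].
  by rewrite dsum_small // occupied_gt0.
by rewrite -d_num_occupied //; lia.
Qed.

End OneFilling.

End Fillings.

Theorem mainTheorem1
    (f : forall p : nat, p.-tuple 'I_p)
    (hf : forall p : nat, 0 < p -> polite_filling (f p) && starts_leftmost (f p))
    (n : nat) (hn : 0 < n) :
  a_num n = \sum_(1 <= i < n.+1) \prod_(1 <= j < n)
    (2 ^ (d_num (f i) j + d_num (f (n + 1 - i)) j) *
     (b_num (f i) j + b_num (f (n + 1 - i)) j)`!).
Proof.
rewrite a_num_sum // big_add1 big_mkord; apply: eq_bigr => z _.
rewrite /completion_count big_nat [RHS]big_nat.
apply: eq_bigr => j /andP[j0 _].
have r0 : 0 < n + 1 - z.+1 by have := ltn_ord z; lia.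
have /andP[Pl Sl] := hf z.+1 isT; have /andP[Pr Sr] := hf _ r0.
rewrite (d_num_leftmost Pl Sl (ltn0Sn z)) // (d_num_leftmost Pr Sr r0) //.
rewrite (b_num_leftmost Pl Sl (ltn0Sn z)) (b_num_leftmost Pr Sr r0).
(* The first choice [z] leaves end gaps of sizes [z] and [n - z.+1]. Each is the only nonempty gap
   of a row one place longer whose leftmost place is taken; the empty gap there has weight 0. *)
rewrite /dsum /bsum !gap_sum_set1 /= !add0n !subn1 /=.
by rewrite (_ : (n + 1 - z.+1).-1 = n - z.+1) //; lia.
Qed.
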